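(* Let $G$ be a connected $\{K_{1,3},B_{1,1}\}$-free graph. Then $G$ is not $P_{5}$-free if and only if $G\in\mathcal{P}(5)$.
   Context: All graphs are finite and simple. A graph is $\mathcal{F}$-free if it contains no member of $\mathcal{F}$ as an induced subgraph. $K_{1,3}$ is the star with three leaves, $P_n$ is the path on $n$ vertices. $B_{1,1}$ is obtained from a triangle $abc$ by adding a vertex adjacent only to $a$ and another vertex adjacent only to $b$. For an integer $l\geq 5$ and pairwise vertex-disjoint nonempty cliques $L_1,\dots,L_l$, the fat $l$-path $F_p(L_1,\dots,L_l)$ is the graph on $L_1\cup\dots\cup L_l$ in which each $L_i$ is a clique, every vertex of $L_i$ is adjacent to every vertex of $L_{i+1}$ for $1\leq i\leq l-1$, and there are no other edges. For pairwise vertex-disjoint nonempty cliques $L_0,\dots,L_l$, the fat $l$-cycle $F_c(L_0,\dots,L_l)$ is the graph on $L_0\cup\dots\cup L_l$ in which each $L_i$ is a clique, every vertex of $L_i$ is adjacent to every vertex of $L_{i+1}$ for $0\leq i\leq l$ (indices modulo $l+1$), and there are no other edges. For $l\geq 5$, $\mathcal{P}(l)$ denotes the family of all fat $i$-paths and fat $i$-cycles for all $i\geq l$ (membership up to isomorphism). *)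

(* Defs.v *)
From mathcomp Require Import all_boot.
From Stdlib Require List.

Set Implicit Arguments.
Unset Strict Implicit.
Unset Printing Implicit Defensive.

Record sgraph := SGraph {
  vertex :> finType;
  edge : rel vertex;
  edge_sym : symmetric edge;
  edge_irrefl : irreflexive edge
}.
Arguments edge {s} x y.

Definition simple_closure (T : finType) (r : rel T) : rel T :=
  [rel x y | (x != y) && (r x y || r y x)].

Lemma simple_closure_sym (T : finType) (r : rel T) :
  symmetric (simple_closure r).
Proof. by move=> x y; rewrite /simple_closure /= eq_sym orbC. Qed.

Lemma simple_closure_irrefl (T : finType) (r : rel T) :
  irreflexive (simple_closure r).
Proof. by move=> x; rewrite /simple_closure /= eqxx. Qed.

Definition sgraph_of (T : finType) (r : rel T) : sgraph :=
  SGraph (simple_closure_sym r) (simple_closure_irrefl r).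

Definition connected_graph (G : sgraph) : Prop :=
  forall x y : G, connect edge x y.

Definition isomorphic (G H : sgraph) : Prop :=
  exists2 f : G -> H, bijective f & {mono f : x y / edge x y}.

(* G has an induced subgraph isomorphic to H. *)
Definition contains_induced (G H : sgraph) : Prop :=
  exists2 f : H -> G, injective f & {mono f : x y / edge x y}.

Definition free (F : seq sgraph) (G : sgraph) : Prop :=
  forall H, List.In H F -> ~ contains_induced G H.

(* Vertex 0 is the centre of the star. *)
Definition K13 : sgraph := sgraph_of [rel i j : 'I_4 | (i : nat) == 0].

Definition path_graph (n : nat) : sgraph :=
  sgraph_of [rel i j : 'I_n | i.+1 == j].

(* a, b, c are 0, 1, 2; the pendant vertices at a and b are 3 and 4. *)
Definition B11 : sgraph :=
  sgraph_of [rel i j : 'I_5 |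
    ((i : nat), (j : nat)) \in [:: (0, 1); (1, 2); (0, 2); (0, 3); (1, 4)]].

(* The cliques are indexed from 0; the tagged sum makes them disjoint. *)
Definition fat_path (l : nat) (L : 'I_l -> finType) : sgraph :=
  sgraph_of [rel x y : {i : 'I_l & L i} |
    (tag x == tag y) || ((tag x).+1 == tag y)].

(* A fat l-cycle has l + 1 cliques; ordS is the successor modulo l + 1. *)
Definition fat_cycle (l : nat) (L : 'I_l.+1 -> finType) : sgraph :=
  sgraph_of [rel x y : {i : 'I_l.+1 & L i} |
    (tag x == tag y) || (ordS (tag x) == tag y)].

Definition is_fat_path (l : nat) (G : sgraph) : Prop :=
  5 <= l /\
  exists2 L : 'I_l -> finType,
    forall i, 0 < #|L i| & isomorphic G (fat_path L).

Definition is_fat_cycle (l : nat) (G : sgraph) : Prop :=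
  5 <= l /\
  exists2 L : 'I_l.+1 -> finType,
    forall i, 0 < #|L i| & isomorphic G (fat_cycle L).

Definition fat_family (l : nat) (G : sgraph) : Prop :=
  exists2 i, l <= i & is_fat_path i G \/ is_fat_cycle i G.

(* Main.v *)
(** Let [p] be a longest induced path of [G], on [n >= 5] vertices.  Claw- and
    bull-freeness, maximality and connectedness force every vertex to have the
    same closed neighbourhood on [p] as some [p i], or else to see exactly the
    two endpoints of [p].  Replacing [p i] by a vertex [x] of type [i], or
    dropping an endpoint and attaching at the other end a vertex seeing both
    endpoints, gives another longest induced path; applying the classification
    to these new paths shows that adjacency depends on the types only.  So [G]
    is a fat cycle or a fat path, according to whether or not some vertex sees
    exactly the two endpoints. *)

Require Import Defs.
From mathcomp Require Import all_boot.
From mathcomp Require Import zify.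

Set Implicit Arguments.
Unset Strict Implicit.
Unset Printing Implicit Defensive.

(** * Closed neighbourhoods of positions on paths and cycles *)

Definition near (i k : nat) : bool := (i <= k.+1) && (k <= i.+1).

(** Closed adjacency in the cycle on [0], ..., [n]; position [n] closes up a path on [n]
    vertices. *)
Definition cnear (n i k : nat) : bool :=
  [|| near i k, (i == 0) && (k == n) | (i == n) && (k == 0)].

(** Column [m-1] (if [m > 0]) and column [j+1] (if [j+1 < n]) both distinguish the rows, so one row
    is at an end. Only the rows [0, 1] with [i = 2] and the rows [n-2, n-1] with [i = n-3]
    survive. *)
Lemma near_perturbed n i j m : 5 <= n -> m < j < n ->
  (forall k, k < n -> near j k != near m k -> k = i) ->
  [&& 2 <= i, i.+2 < n & (j < 2) || (n <= m.+2)].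
Proof.
move=> n5 /andP[mj jn] eqi.
have m_pred : 0 < m -> m.-1 = i by move=> m0; apply: eqi; rewrite /near; lia.
case: (ltnP j.+1 n) => j1.
  have ji : j.+1 = i by apply: eqi; rewrite /near; lia.
  have m0 : m = 0 by case: posnP m_pred => // _ /(_ isT); lia.
  case: (ltnP j 2) => j2; first by lia.
  have : 0 = i by apply: eqi; rewrite /near; lia.
  by lia.
case: (leqP n m.+2) => m2; first by move: m_pred; lia.
have ni : n.-1 = i by apply: eqi; rewrite /near; lia.
case: (posnP m) m_pred => [m0 _|m0]; last by lia.
have : 0 = i by apply: eqi; rewrite /near; lia.
by lia.
Qed.

(** Compares the types of one vertex on two paths that differ only at position [i]. No number meets
    both the condition on [i] and the one on [j], which settles [adj_type_lt]; and [i = n-1] is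
    excluded, which settles [adj_type_last]. *)
Lemma cnear_perturbed n i j m : 5 <= n -> j < n -> m <= n ->
  (forall k, k < n -> k != i -> cnear n j k = cnear n m k) -> m != j ->
  [&& 2 <= i, i.+2 < n & (j < 2) || (n <= j.+2)].
Proof.
move=> n5 jn mn em mj.
have eqi k : k < n -> cnear n j k != cnear n m k -> k = i.
  by move=> kn; apply: contra_neq_eq; apply: em.
have cnear_lt i' k : i' < n -> k < n -> cnear n i' k = near i' k.
  by rewrite /cnear; lia.
case: (ltnP m n) => m_n.
  have eqn k : k < n -> near j k != near m k -> k = i.
    by move=> kn; rewrite -!cnear_lt //; apply: eqi.
  case: (ltngtP m j) mj => // lt_mj _.
    have /and3P[-> -> /=] : [&& 2 <= i, i.+2 < n & (j < 2) || (n <= m.+2)].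
      by apply: near_perturbed => //; apply/andP.
    by lia.
  have /and3P[-> -> /=] : [&& 2 <= i, i.+2 < n & (m < 2) || (n <= j.+2)].
    apply: near_perturbed => //; first by apply/andP.
    by move=> k kn; rewrite eq_sym; apply: eqn.
  by lia.
have m_eq : m = n by lia.
(* Row [n] is [{0, n-1}], which differs from every other row in at least two columns. *)
subst m; exfalso.
case: (posnP j) => [j0|j0].
  have : 1 = i by apply: eqi; rewrite /cnear /near; lia.
  have : n.-1 = i by apply: eqi; rewrite /cnear /near; lia.
  by lia.
case: (ltnP j.+1 n) => j1.
  have ji : j = i by apply: eqi; rewrite /cnear /near; lia.
  case: (ltnP 1 j) => j2.
    have : j.-1 = i by apply: eqi; rewrite /cnear /near; lia.
    by lia.
  have : j.+1 = i by apply: eqi; rewrite /cnear /near; lia.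
  by lia.
have : n.-2 = i by apply: eqi; rewrite /cnear /near; lia.
have : 0 = i by apply: eqi; rewrite /cnear /near; lia.
by lia.
Qed.

(** * Closed adjacency, induced paths, claws and bulls *)

Section Adjacency.
Variable G : sgraph.
Implicit Types (x y : G) (p : nat -> G).

Definition adj x y : bool := (x == y) || edge x y.

Lemma adjxx x : adj x x.
Proof. by rewrite /adj eqxx. Qed.

Lemma adj_sym x y : adj x y = adj y x.
Proof. by rewrite /adj eq_sym edge_sym. Qed.

Lemma edge_adj x y : edge x y = adj x y && (x != y).
Proof.
by rewrite /adj; case: eqVneq => [->|]; rewrite ?edge_irrefl ?andbT.
Qed.

(** Only the values below [n] matter; a total [p] is easy to shift and extend. *)
Definition induced_path n p : Prop :=
  forall i j, i < n -> j < n -> adj (p i) (p j) = near i j.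

(** Equal vertices have equal rows of [near], and the rows are distinct. *)
Lemma induced_path_inj n p : 4 <= n -> induced_path n p ->
  forall i j, i < n -> j < n -> p i = p j -> i = j.
Proof.
move=> n4 ip.
suff lt_absurd i j : i < j -> j < n -> p i = p j -> False.
  move=> i j ni nj E; case: (ltngtP i j) => // ij; case: (lt_absurd _ _ ij) => //.
move=> ij jn E.
have eq_near k : k < n -> near i k = near j k.
  by move=> kn; rewrite -!ip ?E //; lia.
case: (ltnP j.+1 n) => jn1; first by move: (eq_near _ jn1); rewrite /near; lia.
move: (eq_near 0) (eq_near i.-1) (eq_near i.+2) (eq_near i.+1).
by rewrite /near; lia.
Qed.

Lemma induced_path_size n p : 4 <= n -> induced_path n p -> n <= #|G|.
Proof.
move=> n4 ip; rewrite -[n in n <= _]card_ord.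
apply: (@leq_card _ _ (fun i : 'I_n => p i)) => i j /(induced_path_inj n4 ip) E.
by apply: val_inj; apply: E.
Qed.

Lemma contains_path n p : 4 <= n -> induced_path n p ->
  contains_induced G (path_graph n).
Proof.
move=> n4 ip; exists (fun i : 'I_n => p i) => [i j|i j].
  by move/(induced_path_inj n4 ip) => E; apply: val_inj; apply: E.
rewrite edge_adj ip // /= /simple_closure /=.
have -> : (p i != p j) = (i != j).
  congr (~~ _); apply/eqP/eqP => [/(induced_path_inj n4 ip) E|->//].
  by apply: val_inj; apply: E.
by rewrite -val_eqE /= /near; lia.
Qed.

Lemma induced_path_contained n : contains_induced G (path_graph n) ->
  0 < n -> exists p, induced_path n p.
Proof.
case=> f finj fmono; case: n f finj fmono => // n f finj fmono _.
exists (fun i => f (inord i)) => i j ni nj.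
rewrite /adj fmono (inj_eq finj) /= /simple_closure /= -val_eqE /= !inordK //.
by rewrite /near; lia.
Qed.

(* Closed adjacency separates the vertices of the claw and of the bull, so no
   disequality hypotheses are needed. *)
Lemma contains_claw c x y z : adj c x -> adj c y -> adj c z ->
  ~~ adj x y -> ~~ adj x z -> ~~ adj y z -> contains_induced G K13.
Proof.
move=> cx cy cz /negbTE xy /negbTE xz /negbTE yz.
have := (adjxx c, adjxx x, adjxx y, adjxx z) => -[[[rc rx] ry] rz].
have := (adj_sym c x, adj_sym c y, adj_sym c z).
have := (adj_sym x y, adj_sym x z, adj_sym y z).
rewrite cx cy cz xy xz yz => -[[yx zx] zy] [[xc yc] zc].
pose f (i : 'I_4) := nth c [:: c; x; y; z] i.
have finj : injective f.
  move=> [[|[|[|[|//]]]] ?] [[|[|[|[|//]]]] ?] E; apply: val_inj => //=;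
  exfalso; rewrite /f /= in E; congruence.
exists f => // i j; rewrite edge_adj (inj_eq finj) /= /simple_closure /=.
rewrite andbC -val_eqE; move: i j.
by move=> [[|[|[|[|//]]]] ?] [[|[|[|[|//]]]] ?] /=;
  rewrite /f /= ?(cx, cy, cz, xc, yc, zc, xy, xz, yz, yx, zx, zy).
Qed.

Lemma contains_bull a b c d e : adj a b -> adj b c -> adj a c ->
  adj a d -> adj b e -> ~~ adj a e -> ~~ adj b d -> ~~ adj c d ->
  ~~ adj c e -> ~~ adj d e -> contains_induced G B11.
Proof.
move=> ab bc ac ad be /negbTE ae /negbTE bd /negbTE cd /negbTE ce /negbTE de.
have := (adjxx a, adjxx b, adjxx c, adjxx d, adjxx e) => -[[[[ra rb] rc] rd] re].
have := (adj_sym a b, adj_sym b c, adj_sym a c, adj_sym a d, adj_sym b e).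
have := (adj_sym a e, adj_sym b d, adj_sym c d, adj_sym c e, adj_sym d e).
rewrite ab bc ac ad be ae bd cd ce de.
move=> -[[[[ea db] dc] ec] ed] [[[[ba cb] ca] da] eb].
pose f (i : 'I_5) := nth a [:: a; b; c; d; e] i.
have finj : injective f.
  move=> [[|[|[|[|[|//]]]]] ?] [[|[|[|[|[|//]]]]] ?] E; apply: val_inj => //=;
  exfalso; rewrite /f /= in E; congruence.
exists f => // i j; rewrite edge_adj (inj_eq finj) /= /simple_closure /=.
rewrite andbC -val_eqE; move: i j.
by move=> [[|[|[|[|[|//]]]]] ?] [[|[|[|[|[|//]]]]] ?] /=;
  rewrite /f /= ?(ab, bc, ac, ad, be, ba, cb, ca, da, eb, ae, bd, cd, ce, de,
                  ea, db, dc, ec, ed).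
Qed.

End Adjacency.

(** * Vertex types along a longest induced path *)

Section LongestPath.
Variable G : sgraph.
Hypothesis G_connected : connected_graph G.
Hypothesis G_free : free [:: K13; B11] G.
Variable n : nat.
Hypothesis n_ge5 : 5 <= n.
Hypothesis n_max : forall p : nat -> G, ~ induced_path n.+1 p.
Implicit Types (x y : G) (p : nat -> G).

Lemma no_claw (c x y z : G) : adj c x -> adj c y -> adj c z ->
  ~~ adj x y -> ~~ adj x z -> ~~ adj y z -> False.
Proof.
move=> cx cy cz xy xz yz; apply: (G_free (H := K13)); first by left.
exact: (contains_claw cx cy cz).
Qed.

Lemma no_bull (a b c d e : G) : adj a b -> adj b c -> adj a c ->
  adj a d -> adj b e -> ~~ adj a e -> ~~ adj b d -> ~~ adj c d ->
  ~~ adj c e -> ~~ adj d e -> False.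
Proof.
move=> ab bc ac ad be ae bd cd ce de.
apply: (G_free (H := B11)); first by right; left.
exact: (contains_bull ab bc ac ad be).
Qed.

(* For [i < n], the closed neighbourhood of [x] on the path is that of [p i];
   for [i = n], it consists of the two endpoints. *)
Definition has_type p x i : Prop :=
  forall k, k < n -> adj x (p k) = cnear n i k.

Section Path.
Variable p : nat -> G.
Hypothesis p_path : induced_path n p.
Variable x : G.
Let a k := adj x (p k).

(** Otherwise [p i] is the centre of a claw. *)
Lemma nbr_interior i : 0 < i -> i.+1 < n -> a i -> a i.-1 || a i.+1.
Proof.
rewrite /a => i0 i1 ai; apply/negP => /negP; rewrite negb_or => /andP[al ar].
apply: (@no_claw (p i) x (p i.-1) (p i.+1)) => //; first by rewrite adj_sym.
all: rewrite p_path /near; lia.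
Qed.

(** Three pairwise nonadjacent neighbours would make [x] the centre of a claw. *)
Lemma nbr_spread i j k : i.+1 < j -> j.+1 < k -> k < n -> a i -> a j ->
  ~~ a k.
Proof.
rewrite /a => ij jk kn ai aj; apply/negP => ak.
by apply: (@no_claw x (p i) (p j) (p k)) => //; rewrite p_path /near; lia.
Qed.

(** Otherwise the triangle [p (i+1)], [p (i+2)], [x] has pendants [p i] and [p (i+3)]: a bull. *)
Lemma nbr_edge i : i.+3 < n -> a i.+1 -> a i.+2 -> a i || a i.+3.
Proof.
rewrite /a => i1 ai aj; apply/negP => /negP; rewrite negb_or => /andP[al ar].
apply: (@no_bull (p i.+1) (p i.+2) x (p i) (p i.+3)) => //.
all: by rewrite 1?adj_sym // p_path /near; lia.
Qed.

(** A bull on the triangle [p i], [p (i+1)], [x], with pendants [p (i+2)] and [p k]; [nbr_far_left]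
    is the mirror image. *)
Lemma nbr_far_right i k : i.+2 < n -> k < n -> a i -> a i.+1 -> ~~ a i.+2 ->
  (k.+1 < i) || (i.+3 < k) -> ~~ a k.
Proof.
rewrite /a => i1 kn ai aj al ik; apply/negP => ak.
apply: (@no_bull (p i.+1) x (p i) (p i.+2) (p k)) => //.
all: by rewrite 1?adj_sym // p_path /near; lia.
Qed.

Lemma nbr_far_left i k : i.+2 < n -> k < n -> a i.+1 -> a i.+2 -> ~~ a i ->
  (k.+1 < i) || (i.+3 < k) -> ~~ a k.
Proof.
rewrite /a => i1 kn ai aj al ik; apply/negP => ak.
apply: (@no_bull (p i.+1) x (p i.+2) (p i) (p k)) => //.
all: by rewrite 1?adj_sym // p_path /near; lia.
Qed.


(** At an end, [x] would prolong the path, against [n_max]; inside, [nbr_interior] applies. *)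
Lemma nbr_not_singleton m : m < n -> ~ (forall k, k < n -> a k = (k == m)).
Proof.
move=> mn am; have amk k : k < n -> adj x (p k) = (k == m) := am k.
case: (posnP m) => [m0|m_gt0].
  apply: (@n_max (fun k => if k is k'.+1 then p k' else x)) => -[|i] [|j] ni nj.
  - by rewrite adjxx.
  - by rewrite amk // /near; lia.
  - by rewrite adj_sym amk // /near; lia.
  - by rewrite p_path.
case: (ltnP m.+1 n) => [m_lt|m_ge].
  have := @nbr_interior m m_gt0 m_lt; rewrite !am //; lia.
apply: (@n_max (fun k => if k < n then p k else x)) => i j ni nj.
case: ltnP => i_n; case: ltnP => j_n.
- by rewrite p_path.
- by rewrite adj_sym amk // /near; lia.
- by rewrite amk // /near; lia.
- by rewrite adjxx /near; lia.
Qed.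

(** The least neighbour [i] decides. If [i > 0], the type is [i+1]. If [i = 0], it is [0] or [1]
    when [x] sees [p 1], and [n] otherwise. *)
Lemma nbr_type k : k < n -> a k -> exists2 i, i <= n & has_type p x i.
Proof.
move=> kn ak.
have ex_nbr : exists k, (k < n) && a k by exists k; rewrite kn.
case: (ex_minnP ex_nbr) => i /andP[i_n ai] i_min {k kn ak ex_nbr}.
have a_lt k : k < i -> a k = false.
  by move=> ki; apply/negP => ak; have := i_min k; rewrite ak; lia.
have interval m : m < n -> i <= m ->
  (forall k, k < n -> i <= k -> a k = near m k) ->
  (forall k, k < i -> near m k = false) -> exists2 i, i <= n & has_type p x i.
  move=> mn im am lt_m; exists m; first by lia.
  move=> k kn; rewrite -/(a k).
  have -> : cnear n m k = near m k by rewrite /cnear; lia.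
  by case: (ltnP k i) => ki; [rewrite a_lt ?lt_m | rewrite am].
have single : (forall k, k < n -> i < k -> a k = false) -> False.
  move=> gt_i; apply: (nbr_not_singleton i_n) => k kn.
  by case: (ltngtP k i) => [/a_lt|/(gt_i _ kn)|->].
case: (posnP i) => [i0|i_gt0].
  rewrite {}i0 in ai single interval.
  case a1: (a 1).
    case a2: (a 2).
      have na4 : ~~ a 4 by apply: (@nbr_spread 0 2 4).
      have na3 : ~~ a 3.
        apply/negP => a3; suff: ~~ a 0 by rewrite ai.
        by apply: (@nbr_far_right 2) => //; lia.
      apply: (interval 1) => //; first by lia.
      move=> [|[|[|[|k]]]] kn _; rewrite ?ai ?a1 ?a2 ?(negbTE na3) //.
      by apply/negbTE/(@nbr_spread 0 2).
    have a_ge4 k : 3 < k -> k < n -> a k = false.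
      by move=> k3 kn; apply/negbTE/(@nbr_far_right 0) => //; rewrite ?a2; lia.
    have a3 : a 3 = false.
      apply/negP => a3; have := @nbr_interior 3; rewrite a2 a3 a_ge4 //; lia.
    apply: (interval 0) => //; first by lia.
    by move=> [|[|[|[|k]]]] kn _; rewrite ?ai ?a1 ?a2 ?a3 ?a_ge4.
  case: (boolP [exists k : 'I_n, (0 < k) && a k]); last first.
    move=> /existsPn no_nbr; case: single => k kn k0.
    by have := no_nbr (Ordinal kn); rewrite /= k0 => /negbTE.
  case/existsP => k0 /andP[k0_gt0 ak0].
  have ex_nbr : exists k, [&& 0 < k, k < n & a k].
    by exists k0; rewrite k0_gt0 ltn_ord.
  case: (ex_minnP ex_nbr) => j /and3P[j0 j_n aj] j_min {k0 k0_gt0 ak0 ex_nbr}.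
  have a_lt_j k : 0 < k -> k < j -> a k = false.
    by move=> ki kj; apply/negP => ak; have := j_min k; rewrite ak; lia.
  have j_neq1 : j != 1 by apply: contraTneq aj => ->; rewrite a1.
  (* If the second neighbour [j] is not the last position, then [j+1] is a neighbour too. This pair
     gives a bull, by [nbr_edge] if [j = 2] and together with [p 0] if [j > 2]. *)
  case: (ltnP j.+1 n) => j_n1.
    have aj1 : a j.+1.
      by have := @nbr_interior j j0 j_n1 aj; rewrite (a_lt_j j.-1); lia.
    case: (leqP j 2) => j2.
      have j_eq2 : j = 2 by lia.
      rewrite {}j_eq2 in aj aj1; have := @nbr_edge 1; rewrite a1 aj aj1 => /=.
      have /negbTE -> : ~~ a 4 by apply: (@nbr_spread 0 2 4).
      by move=> /(_ n_ge5 isT isT).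
    suff: ~~ a 0 by rewrite ai.
    by apply: (@nbr_far_left j.-1); rewrite ?prednK //; rewrite ?a_lt_j //; lia.
  exists n => // k kn; rewrite -/(a k) /cnear /near.
  case: (posnP k) => [->|k_gt0]; first by rewrite ai; lia.
  case: (ltngtP k j) => [kj|kj|->]; last by rewrite aj; lia.
    by rewrite a_lt_j //; lia.
  lia.
(* If [i = n-1], it would be the only neighbour. *)
have i1_n : i.+1 < n.
  by rewrite ltnNge; apply/negP => ni; apply: single => k; lia.
have ai1 : a i.+1.
  by have := @nbr_interior i i_gt0 i1_n ai; rewrite (a_lt i.-1); lia.
apply: (interval i.+1) => //; try lia; last by move=> k; rewrite /near; lia.
move=> k kn ik.
case: (eqVneq k i) => [->|ki]; first by rewrite ai /near; lia.
case: (eqVneq k i.+1) => [->|ki1]; first by rewrite ai1 /near; lia.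
have i2_n : i.+2 < n by lia.
have ai2 : a i.+2.
  have := @nbr_edge i.-1; rewrite prednK // ai ai1 (a_lt i.-1); last by lia.
  by apply; lia.
case: (eqVneq k i.+2) => [->|ki2]; first by rewrite ai2 /near; lia.
have -> : near i.+1 k = false by rewrite /near; lia.
apply/negbTE; case: (eqVneq k i.+3) => [ki3|ki3].
  by apply: (@nbr_far_left i.-1); rewrite ?prednK //; rewrite ?a_lt //; lia.
by apply: (@nbr_spread i i.+2) => //; lia.
Qed.

End Path.

(** * Modified longest paths, and adjacency determined by types *)

Lemma replace_path p x i : induced_path n p -> i < n -> has_type p x i ->
  induced_path n (fun k => if k == i then x else p k).
Proof.
move=> ip i_n tx j k jn kn.
case: eqVneq => [->|ji]; case: eqVneq => [->|ki].
- by rewrite adjxx /near; lia.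
- by rewrite tx // /cnear /near; lia.
- by rewrite adj_sym tx // /cnear /near; lia.
- exact: ip.
Qed.

(** Once [p 0] is dropped, [x] sees only [p (n-1)] and can follow it. *)
Lemma rotate_path p x : induced_path n p -> has_type p x n ->
  induced_path n (fun k => if k.+1 < n then p k.+1 else x).
Proof.
move=> ip tx j k jn kn.
case: ltnP => jn1; case: ltnP => kn1.
- by rewrite ip.
- by rewrite adj_sym tx // /cnear /near; lia.
- by rewrite tx // /cnear /near; lia.
- by rewrite adjxx /near; lia.
Qed.

(** By connectedness it is enough that domination passes along edges. If [y] is dominated and its
    neighbour [z] is not, put [y] on the path by replacement or rotation: [z] then sees exactly one
    path vertex. *)
Lemma path_dominates p x : induced_path n p -> exists2 k, k < n & adj x (p k).
Proof.
move=> ip; pose D := [pred y | [exists k : 'I_n, adj y (p k)]].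
suff /existsP[k xk] : D x by exists k.
have n_gt0 : 0 < n by lia.
have D0 : D (p 0) by apply/existsP; exists (Ordinal n_gt0); apply: adjxx.
suff D_closed y z : edge y z -> D y -> D z.
  case/connectP: (G_connected (p 0) x) => q; elim: q (p 0) D0 => [|z q IH] y Dy.
    by move=> _ /= ->.
  by case/andP=> yz qz; apply: IH qz; apply: D_closed yz Dy.
move=> yz /existsP[k yk]; apply: contraT => Dz; have z_far := existsPn Dz; exfalso.
have zF j : j < n -> adj z (p j) = false.
  by move=> jn; apply/negbTE/(z_far (Ordinal jn)).
have zy : adj z y by rewrite adj_sym /adj yz orbT.
have [i i_le ty] := nbr_type ip (ltn_ord k) yk.
case: (ltnP i n) => i_n.
  apply: (nbr_not_singleton (replace_path ip i_n ty) (x := z) i_n) => j jn.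
  by case: eqVneq => // _; apply: zF.
have i_eqn : i = n by lia.
rewrite {}i_eqn in ty.
have n1_n : n.-1 < n by lia.
apply: (nbr_not_singleton (rotate_path ip ty) (x := z) n1_n) => j jn.
by case: ltnP => j1; [rewrite zF | rewrite zy]; lia.
Qed.

Lemma vertex_type p x : induced_path n p ->
  exists2 i, i <= n & has_type p x i.
Proof.
by move=> ip; have [k kn xk] := path_dominates x ip; apply: (nbr_type ip kn xk).
Qed.

(** Put [x] at position [i], or [y] at position [j]. If the other vertex keeps its type in one of
    the two new paths, the adjacency can be read off there. Both types cannot change, by
    [cnear_perturbed]. *)
Lemma adj_type_lt p x y i j : induced_path n p -> i < n -> j < n ->
  has_type p x i -> has_type p y j -> adj x y = near i j.
Proof.
move=> ip i_n j_n tx ty.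
have [m m_le tm] := vertex_type y (replace_path ip i_n tx).
have [m' m'_le tm'] := vertex_type x (replace_path ip j_n ty).
have := tm i i_n; rewrite eqxx adj_sym => xy.
have := tm' j j_n; rewrite eqxx => xy'.
have em k : k < n -> k != i -> cnear n j k = cnear n m k.
  by move=> kn ki; rewrite -tm // (negbTE ki) ty.
have em' k : k < n -> k != j -> cnear n i k = cnear n m' k.
  by move=> kn ki; rewrite -tm' // (negbTE ki) tx.
case: (eqVneq m j) => [mj|/(cnear_perturbed n_ge5 j_n m_le em)/and3P[]].
  by rewrite xy mj /cnear /near; lia.
case: (eqVneq m' i) => [mi|/(cnear_perturbed n_ge5 i_n m'_le em')/and3P[]].
  by rewrite xy' mi /cnear /near; lia.
lia.
Qed.

(** Rotation puts [x] at position [n-1] and should lower the type of [y] by one modulo [n+1]. Only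
    column [n-1] is unknown, and [cnear_perturbed] rules out an exception there. *)
Lemma adj_type_last p x y j : induced_path n p -> j <= n ->
  has_type p x n -> has_type p y j -> adj x y = cnear n n j.
Proof.
move=> ip j_n tx ty.
have [m m_le tm] := vertex_type y (rotate_path ip tx).
have n1_n : n.-1 < n by lia.
have := tm _ n1_n; rewrite prednK ?ltnn; last by lia.
rewrite adj_sym => ->.
have em k : k.+1 < n -> cnear n j k.+1 = cnear n m k.
  by move=> kn; rewrite -tm ?kn ?ty //; lia.
case: (posnP j) => [j0|j_gt0].
  case: (eqVneq n m) => [<-|nm]; first by rewrite j0 /cnear /near; lia.
  have m_n : m < n by lia.
  have ec k : k < n -> k != n.-1 -> cnear n m k = cnear n n k.
    by move=> kn kn1; rewrite -em; rewrite ?j0 /cnear /near; lia.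
  by have := cnear_perturbed n_ge5 m_n (leqnn n) ec nm; lia.
case: (eqVneq m j.-1) => [->|mj]; first by rewrite /cnear /near; lia.
have j1_n : j.-1 < n by lia.
have ec k : k < n -> k != n.-1 -> cnear n j.-1 k = cnear n m k.
  by move=> kn kn1; rewrite -em; rewrite /cnear /near; lia.
by have := cnear_perturbed n_ge5 j1_n m_le ec mj; lia.
Qed.

Lemma adj_type p x y i j : induced_path n p -> i <= n -> j <= n ->
  has_type p x i -> has_type p y j -> adj x y = cnear n i j.
Proof.
move=> ip i_n j_n tx ty.
case: (eqVneq i n) => [i_eq|i_neq].
  by rewrite i_eq in tx *; apply: adj_type_last ip j_n tx ty.
case: (eqVneq j n) => [j_eq|j_neq].
  rewrite j_eq in ty *; rewrite adj_sym (adj_type_last ip i_n ty tx).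
  by rewrite /cnear /near; lia.
rewrite (adj_type_lt ip _ _ tx ty); try lia.
by rewrite /cnear; lia.
Qed.

End LongestPath.

(** * Recognising fat paths and fat cycles *)

Lemma adj_fat_path l (L : 'I_l -> finType) (u v : fat_path L) :
  adj u v = near (tag u) (tag v).
Proof.
rewrite /adj /= /simple_closure /= -!val_eqE /=.
by case: eqVneq => [->|_] /=; rewrite /near; lia.
Qed.

Lemma ordS_eq l (i j : 'I_l.+1) :
  (ordS i == j) = (i.+1 == j) || (i == l :> nat) && (j == 0 :> nat).
Proof.
rewrite -val_eqE /=; move: (ltn_ord i) (ltn_ord j).
by case: (eqVneq (i : nat) l) => [->|il] il1 jl;
  rewrite ?modnn ?modn_small; lia.
Qed.

Lemma adj_fat_cycle l (L : 'I_l.+1 -> finType) (u v : fat_cycle L) :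
  adj u v = cnear l (tag u) (tag v).
Proof.
rewrite /adj /= /simple_closure /= !ordS_eq -!val_eqE /=.
move: (ltn_ord (tag u)) (ltn_ord (tag v)).
by case: eqVneq => [->|_] /=; rewrite /cnear /near; lia.
Qed.

(** Presents [T] as the disjoint union of the fibres of [c], in the tagged form used by fat
    graphs. *)
Definition fiber_tag (T : finType) (I : eqType) (c : T -> I) (x : T) :
    {i : I & {x : T | c x == i}} :=
  Tagged (fun i => {x : T | c x == i})
    (exist (fun y => c y == c x) x (eqxx (c x))).

Lemma fiber_tag_bij (T : finType) (I : eqType) (c : T -> I) :
  bijective (fiber_tag c).
Proof.
exists (fun u : {i : I & {x : T | c x == i}} => sval (tagged u)) => //.
(* Once [i] is replaced by [c x], the two membership proofs agree by boolean irrelevance. *)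
move=> [i [x xi]]; have cxi := eqP xi; case: i / cxi xi => xi.
by rewrite /fiber_tag /= (bool_irrelevance xi (eqxx (c x))).
Qed.

Section Isomorphism.
Variable G : sgraph.

Lemma fat_path_iso l (c : G -> 'I_l) :
  (forall x y : G, adj x y = near (c x) (c y)) ->
  isomorphic G (fat_path (fun i => {x : G | c x == i})).
Proof.
move=> c_adj; exists (fiber_tag c) => [|x y]; first exact: fiber_tag_bij.
rewrite !edge_adj adj_fat_path c_adj; congr (_ && ~~ _).
exact: (bij_eq (fiber_tag_bij c)).
Qed.

Lemma fat_cycle_iso l (c : G -> 'I_l.+1) :
  (forall x y : G, adj x y = cnear l (c x) (c y)) ->
  isomorphic G (fat_cycle (fun i => {x : G | c x == i})).
Proof.
move=> c_adj; exists (fiber_tag c) => [|x y]; first exact: fiber_tag_bij.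
rewrite !edge_adj adj_fat_cycle c_adj; congr (_ && ~~ _).
exact: (bij_eq (fiber_tag_bij c)).
Qed.

(** The cliques are the fibres of the type map [c]. For [i < n], the vertex [p i] inhabits fibre
    [i]; fibre [n] decides between cycle and path. *)
Lemma fat_family_of_longest_path n (p : nat -> G) : 5 <= n ->
  (forall q : nat -> G, ~ induced_path n.+1 q) ->
  connected_graph G -> free [:: K13; B11] G ->
  induced_path n p -> fat_family 5 G.
Proof.
move=> n5 n_max conn fr ip; exists n => //.
have ex_type x :
  exists i : 'I_n.+1, [forall k : 'I_n, adj x (p k) == cnear n i k].
  have [i i_n ti] := vertex_type conn fr n5 n_max x ip.
  have i_n1 : i < n.+1 by [].
  by exists (Ordinal i_n1); apply/forallP => k; rewrite ti.
pose c x := xchoose (ex_type x).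
have cT x : has_type n p x (c x).
  move=> k kn; have /forallP/(_ (Ordinal kn))/eqP := xchooseP (ex_type x).
  exact.
have c_le x : c x <= n by rewrite -ltnS.
have cp i : i < n -> c (p i) = i :> nat.
  move=> i_n; have ec k : k < n -> near i k = cnear n (c (p i)) k.
    by move=> kn; rewrite -ip // cT.
  apply/eqP/negP => /negP ci.
  (* The rows agree everywhere; [n-1] is named as exceptional column because [cnear_perturbed]
     forbids it. *)
  have ec' k : k < n -> k != n.-1 -> cnear n i k = cnear n (c (p i)) k.
    by move=> kn _; rewrite -ec // /cnear; lia.
  by have := cnear_perturbed n5 i_n (c_le (p i)) ec' ci; lia.
have c_adj x y : adj x y = cnear n (c x) (c y).
  exact: (adj_type conn fr n5 n_max ip).
have [/existsP[v /eqP cv]|/existsPn no_n] := boolP [exists x, c x == n :> nat].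
  right; split=> //; exists (fun i => {x : G | c x == i}).
    move=> i; apply/card_gt0P; case: (ltnP i n) => i_n.
      have ci : c (p i) == i by rewrite -val_eqE /= cp.
      by exists (exist _ (p i) ci).
    have ci : c v == i by rewrite -val_eqE /= cv; move: (ltn_ord i); lia.
    by exists (exist _ v ci).
  exact: fat_cycle_iso.
left; split=> //.
have c_lt x : c x < n by have := no_n x; have := c_le x; lia.
pose d x := Ordinal (c_lt x).
exists (fun i => {x : G | d x == i}).
  move=> i; apply/card_gt0P.
  have di : d (p i) == i by rewrite -val_eqE /= cp.
  by exists (exist _ (p i) di).
apply: fat_path_iso => x y; rewrite c_adj /cnear /=.
by move: (c_lt x) (c_lt y); lia.
Qed.

(** * Existence of a longest induced path, and the equivalence *)

Definition has_path n : bool :=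
  [exists t : {ffun 'I_n -> G}, forall i, forall j, adj (t i) (t j) == near i j].

Lemma has_pathP n : 0 < n ->
  reflect (exists p : nat -> G, induced_path n p) (has_path n).
Proof.
case: n => // n _; apply: (iffP existsP) => [[t /forallP tP]|[p ip]].
  exists (fun k => t (inord k)) => i j i_n j_n.
  by have /forallP/(_ (inord j))/eqP -> := tP (inord i); rewrite !inordK.
exists [ffun i : 'I_n.+1 => p i].
by apply/forallP => i; apply/forallP => j; rewrite !ffunE ip.
Qed.

(** Injectivity bounds the length by [#|G|], and the boolean [has_path] lets [ex_maxnP] pick the
    maximum. *)
Lemma has_longest_path m : 4 <= m -> has_path m ->
  exists n, [/\ m <= n, has_path n & ~~ has_path n.+1].
Proof.
move=> m4 pm; pose P n := (m <= n) && has_path n.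
have exP : exists n, P n by exists m; rewrite /P leqnn.
have P_bound n : P n -> n <= #|G|.
  case/andP=> mn /has_pathP[|p ip]; first by lia.
  by apply: induced_path_size ip; lia.
case: (ex_maxnP exP P_bound) => n /andP[mn pn] n_max; exists n; split=> //.
by apply/negP => pn1; have := n_max n.+1; rewrite /P pn1; lia.
Qed.

Lemma isomorphic_contains_path (H : sgraph) n (p : nat -> H) : 4 <= n ->
  isomorphic G H -> induced_path n p -> contains_induced G (path_graph n).
Proof.
move=> n4 [f [g fK gK] f_mono] ip; apply: (@contains_path _ _ (g \o p) n4).
move=> i j i_n j_n; rewrite -ip // /adj /= -f_mono !gK.
by rewrite (can_eq gK).
Qed.

End Isomorphism.

Lemma fat_path_has_path l (L : 'I_l -> finType) n : 0 < n <= l ->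
  (forall i, 0 < #|L i|) -> exists p : nat -> fat_path L, induced_path n p.
Proof.
case: l L => [|l] L /andP[n0 nl] L_gt0; first by lia.
pose e i : L i := enum_val (Ordinal (L_gt0 i)).
exists (fun k => Tagged L (e (inord k))) => i j i_n j_n.
by rewrite adj_fat_path /= !inordK //; lia.
Qed.

(** One representative per clique; leaving out the last of the [l+1] cliques cuts the cycle open. *)
Lemma fat_cycle_has_path l (L : 'I_l.+1 -> finType) n : n <= l ->
  (forall i, 0 < #|L i|) -> exists p : nat -> fat_cycle L, induced_path n p.
Proof.
move=> nl L_gt0; pose e i : L i := enum_val (Ordinal (L_gt0 i)).
exists (fun k => Tagged L (e (inord k))) => i j i_n j_n.
by rewrite adj_fat_cycle /= !inordK /cnear; lia.
Qed.

Theorem theorem1p2 (G : sgraph) (G_connected : connected_graph G)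
    (G_free : free [:: K13; B11] G) :
  ~ free [:: path_graph 5] G <-> fat_family 5 G.
Proof.
split=> [not_free|]; last first.
  case=> l _ [] [l5 [L L_gt0 iso]] /(_ (path_graph 5)); apply; try by left.
    have [p ip] := fat_path_has_path (n := 5) l5 L_gt0.
    exact: isomorphic_contains_path iso ip.
  have [p ip] := fat_cycle_has_path l5 L_gt0.
  exact: isomorphic_contains_path iso ip.
(* Deciding [has_path G 5] extracts an actual path from the negated hypothesis. *)
have [path5|no_path5] := boolP (has_path G 5); last first.
  case: not_free => H [<-|[]] /induced_path_contained/(_ isT) path5.
  by move/negP: no_path5; apply; apply/has_pathP.
have [n [n5 path_n no_path]] := has_longest_path (leqnSn 4) path5.
have /has_pathP[|p ip] := path_n; first by lia.
apply: (fat_family_of_longest_path n5 _ G_connected G_free ip) => q iq.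
by move/negP: no_path; apply; apply/has_pathP => //; exists q.
Qed.
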